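(* Let $a,b>0$ and $q\in(0,1]$ be constants, and let $\mathcal{A}:[0,1]\to\mathbb{R}$ be the area function defined in the context. Then for every $k\in(0,1)$ $$\mathcal{A}(k)=a\,b\,q\,\pi-a\,b\,q\,\pi\sum_{i=1}^{\infty}\frac{1}{(2i-1)(i+1)}\left(\frac{(2i-1)!!}{(2i)!!}\right)^2k^{2i}.$$ Moreover, the power series on the right-hand side has radius of convergence $1$, it converges also at $k=1$, and the equality holds also for $k=0$ and $k=1$.
   Context: Here $n!!$ denotes the double factorial. Complete elliptic integrals (in terms of the modulus $k$): $K(k)=\int_0^{\pi/2}\frac{d\theta}{\sqrt{1-k^2\sin^2\theta}}$ for $0\le k<1$, $E(k)=\int_0^{\pi/2}\sqrt{1-k^2\sin^2\theta}\,d\theta$ for $0\le k\le1$, and $D(k)=\frac{K(k)-E(k)}{k^2}$ for $0<k<1$. The area function (area of the egg-shaped part of a Hügelschäffer curve as a function of $k$, with $a,b,q$ treated as constants) is $$\mathcal{A}(k)=\begin{cases} a\,b\,q\,\pi, & k=0,\\ \frac{4}{3}\,a\,b\,q\,\bigl(K(k)+E(k)-D(k)\bigr), & k\in(0,1),\\ \frac{8}{3}\,a\,b\,q, & k=1.\end{cases}$$ *)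

(* Defs.v *)
From Stdlib Require Import Reals Arith.
From Coquelicot Require Import Coquelicot.
Open Scope R_scope.

Fixpoint dfact (n : nat) : nat :=
  match n with
  | S (S m as p) => (S p * dfact m)%nat
  | _ => 1%nat
  end.

(* The argument [k] is the modulus, not the parameter [m = k ^ 2]. *)
Definition ellK (k : R) : R :=
  RInt (fun t => / sqrt (1 - k ^ 2 * sin t ^ 2)) 0 (PI / 2).

Definition ellE (k : R) : R :=
  RInt (fun t => sqrt (1 - k ^ 2 * sin t ^ 2)) 0 (PI / 2).

Definition ellD (k : R) : R := (ellK k - ellE k) / k ^ 2.

(* Total on [R]; only its values for [0 <= k <= 1] are meaningful. *)
Definition egg_area (a b q k : R) : R :=
  if Req_EM_T k 0 then a * b * q * PI
  else if Req_EM_T k 1 then 8 / 3 * a * b * q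
  else 4 / 3 * a * b * q * (ellK k + ellE k - ellD k).

(* Meaningful for [1 <= i]; [2 * i - 1] inside [dfact] is truncated. *)
Definition egg_coeff (i : nat) : R :=
  1 / ((2 * INR i - 1) * (INR i + 1)) *
  (INR (dfact (2 * i - 1)) / INR (dfact (2 * i))) ^ 2.

(* Coefficient of [k ^ n] in the series of [egg_coeff i * k ^ (2 * i)] over
   [1 <= i], as a power series in [k] itself: no constant or odd terms. *)
Definition egg_pcoeff (n : nat) : R :=
  if (Nat.even n && (0 <? n)%nat)%bool then egg_coeff (Nat.div2 n) else 0.

(* Main.v *)
Require Import Defs.
From Stdlib Require Import Reals Arith.
From Coquelicot Require Import Coquelicot.
From Stdlib Require Import Lra Lia.
Open Scope R_scope.

(** For every [k] in [[0, 1]], the area is [4 a b q] times the integral of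
    [cos t ^ 2 * sqrt (1 - k ^ 2 * sin t ^ 2)] over [[0, PI / 2]]: for
    [0 < k < 1] the difference with the combination of [K], [E] and [D] is the
    integral of the derivative of [sin t * cos t * sqrt (1 - k ^ 2 * sin t ^ 2)],
    which vanishes at both ends. The binomial partial sums [P n] of
    [sqrt (1 - x)] satisfy [2 (1 - x) (P n)' + P n = w n * x ^ n] with
    [w n = (2 n - 1)!! / (2 n)!!], whence
    [sqrt (1 - x) <= P n x <= sqrt (1 - x) + w n] on the closed interval
    [[0, 1]]. As [w n] tends to [0], termwise integration is legitimate up to
    and including [k = 1]. *)

(** * Ratios of double factorials: recurrence and two-sided bounds *)

(** At [n = 0] truncated subtraction gives [dfact 0 = 1] in the numerator, which agrees with the
    convention [(-1)!! = 1]. *)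
Definition wallis (n : nat) : R :=
  INR (dfact (2 * n - 1)) / INR (dfact (2 * n)).

Lemma dfact_SS (n : nat) : dfact (S (S n)) = (S (S n) * dfact n)%nat.
Proof. reflexivity. Qed.

Lemma dfact_pos (n : nat) : 0 < INR (dfact n).
Proof.
enough (H : 0 < INR (dfact n) /\ 0 < INR (dfact (S n))) by apply H.
induction n as [|n [IH1 IH2]]; [simpl; lra|].
split; [exact IH2|].
rewrite dfact_SS, mult_INR.
apply Rmult_lt_0_compat; [apply lt_0_INR; lia | exact IH1].
Qed.

Lemma wallis_0 : wallis 0 = 1.
Proof. unfold wallis; simpl; field. Qed.

Lemma wallis_S (n : nat) :
  wallis (S n) = wallis n * (2 * INR n + 1) / (2 * INR n + 2).
Proof.
pose proof (pos_INR n) as Hn.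
unfold wallis.
replace (2 * S n)%nat with (S (S (2 * n))) by lia.
assert (Hodd : INR (dfact (S (S (2 * n)) - 1)) =
               (2 * INR n + 1) * INR (dfact (2 * n - 1))).
(* Because [2 * n - 1] truncates at [n = 0], that case is computed apart. *)
{ destruct n as [|n]; [simpl; lra|].
  replace (S (S (2 * S n)) - 1)%nat with (S (S (2 * S n - 1))) by lia.
  rewrite dfact_SS, mult_INR.
  replace (S (S (2 * S n - 1))) with (2 * S n + 1)%nat by lia.
  rewrite plus_INR, mult_INR. simpl (INR 2). simpl (INR 1). lra. }
rewrite Hodd, dfact_SS, mult_INR.
replace (INR (S (S (2 * n)))) with (2 * INR n + 2)
  by (rewrite !S_INR, mult_INR; simpl; lra).
pose proof (dfact_pos (2 * n)).
field; lra.
Qed.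

Lemma wallis_pos (n : nat) : 0 < wallis n.
Proof. apply Rdiv_lt_0_compat; apply dfact_pos. Qed.

(** The left side starts at [1] and is nonincreasing: consecutive values have ratio
    [(2 n + 1) (2 n + 3) / (2 n + 2) ^ 2 <= 1]. *)
Lemma wallis_sqr_le (n : nat) : wallis n ^ 2 * (2 * INR n + 1) <= 1.
Proof.
induction n as [|n IH]; [rewrite wallis_0; simpl; lra|].
pose proof (pos_INR n) as Hn.
rewrite wallis_S, S_INR.
apply Rle_trans with (2 := IH).
replace ((wallis n * (2 * INR n + 1) / (2 * INR n + 2)) ^ 2 *
         (2 * (INR n + 1) + 1)) with
  (wallis n ^ 2 * (2 * INR n + 1) *
   (((2 * INR n + 1) * (2 * INR n + 3)) / (2 * INR n + 2) ^ 2)) by (field; lra).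
rewrite <- (Rmult_1_r (wallis n ^ 2 * (2 * INR n + 1))) at 2.
apply Rmult_le_compat_l.
- apply Rmult_le_pos; [apply pow2_ge_0 | lra].
- apply Rle_div_l; nra.
Qed.

(** The right side equals [1] at [n = 1] and grows by [wallis n] at each step. This lower bound
    later keeps the radius of convergence from exceeding [1]. *)
Lemma wallis_ge (n : nat) : (1 <= n)%nat -> 1 <= 2 * INR n * wallis n.
Proof.
induction 1 as [|n Hn IH].
- rewrite wallis_S, wallis_0; simpl; lra.
- pose proof (pos_INR n) as Hp.
  pose proof (wallis_pos n) as Hw.
  rewrite wallis_S, S_INR.
  replace (2 * (INR n + 1) * (wallis n * (2 * INR n + 1) / (2 * INR n + 2)))
    with (2 * INR n * wallis n + wallis n) by (field; lra).
  lra.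
Qed.

Lemma is_lim_seq_wallis : is_lim_seq wallis 0.
Proof.
apply is_lim_seq_spec; intros eps.
(* If [wallis n >= eps], then [wallis_sqr_le] gives [eps ^ 2 * (2 n + 1) <= 1], which is impossible
   once [n > 1 / eps ^ 2]. *)
destruct (nfloor_ex (/ (eps ^ 2))) as [N [_ HN]].
{ left; apply Rinv_0_lt_compat, pow_lt, cond_pos. }
exists (S N); intros n Hn.
rewrite Rminus_0_r, Rabs_pos_eq by apply Rlt_le, wallis_pos.
apply Rnot_le_lt; intros Hge.
pose proof (wallis_sqr_le n) as Hw.
pose proof (cond_pos eps) as He.
apply le_INR in Hn; rewrite S_INR in Hn.
assert (H1 : 1 < eps ^ 2 * INR n).
{ assert (He2 : 0 < eps ^ 2) by (apply pow_lt; exact He).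
  rewrite <- (Rinv_r (eps ^ 2)) by lra.
  apply Rmult_lt_compat_l; lra. }
assert (H2 : eps ^ 2 <= wallis n ^ 2) by (apply pow_incr; lra).
pose proof (pos_INR n) as Hp.
nra.
Qed.

(** * Taylor polynomials of [sqrt (1 - x)] with a uniform error bound *)

(** The coefficients come from integrating [-1/2 * (1 - x) ^ (-1/2)], whose series is [-1/2] times
    the sum of [wallis m * x ^ m]. The degree is [n]. *)
Fixpoint sqrt_taylor (n : nat) (x : R) : R :=
  match n with
  | O => 1
  | S m => sqrt_taylor m x - wallis m / (2 * INR m + 2) * x ^ S m
  end.

Lemma sqrt_taylor_at_0 (n : nat) : sqrt_taylor n 0 = 1.
Proof.
induction n as [|n IH]; [reflexivity|].
simpl; rewrite IH; ring.
Qed.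

(** The function [sqrt (1 - x)] solves the homogeneous equation [2 (1 - x) f' + f = 0], so the right
    side is the defect of the polynomial. Each new term cancels the old defect and, by [wallis_S],
    leaves the next one. *)
Lemma sqrt_taylor_ode (n : nat) (x : R) :
  exists d, is_derive (sqrt_taylor n) x d /\
    2 * (1 - x) * d + sqrt_taylor n x = wallis n * x ^ n.
Proof.
induction n as [|n [d [Hd Hode]]].
- exists 0; split; [apply (is_derive_const (V := R_NormedModule))|].
  simpl; rewrite wallis_0; ring.
- pose proof (pos_INR n) as Hn.
  exists (d - wallis n / (2 * INR n + 2) * (INR (S n) * x ^ n)); split.
  + apply (is_derive_minus (V := R_NormedModule) (sqrt_taylor n)
             (fun y => wallis n / (2 * INR n + 2) * y ^ S n)).
    * exact Hd.
    * auto_derive; [exact I|].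
      change (match n with O => 1 | S _ => INR n + 1 end) with (INR (S n)).
      simpl pred; ring.
  + rewrite wallis_S.
    change (sqrt_taylor (S n) x) with
      (sqrt_taylor n x - wallis n / (2 * INR n + 2) * x ^ S n).
    replace (sqrt_taylor n x) with (wallis n * x ^ n - 2 * (1 - x) * d) by lra.
    rewrite S_INR, <- tech_pow_Rmult.
    field; lra.
Qed.

Lemma is_derive_inv_sqrt_1m (x : R) : x < 1 ->
  is_derive (fun y => / sqrt (1 - y)) x (/ (2 * (1 - x) * sqrt (1 - x))).
Proof.
intros Hx.
assert (Hs : 0 < sqrt (1 - x)) by (apply sqrt_lt_R0; lra).
auto_derive; replace (1 + - x) with (1 - x) by ring; [repeat split; lra|].
assert (Hss : sqrt (1 - x) * sqrt (1 - x) = 1 - x) by (apply sqrt_sqrt; lra).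
set (s := sqrt (1 - x)) in *.
rewrite <- Hss.
field; lra.
Qed.

(* The differential inequality says that [f / sqrt (1 - x)] is nondecreasing. *)
Lemma sqrt_1m_comparison (f df : R -> R) (x : R) : 0 <= x < 1 ->
  (forall y, 0 <= y <= x ->
     is_derive f y (df y) /\ 0 <= 2 * (1 - y) * df y + f y) ->
  f 0 * sqrt (1 - x) <= f x.
Proof.
intros Hx Hf.
set (dg := fun y => df y * / sqrt (1 - y) +
                    f y * / (2 * (1 - y) * sqrt (1 - y))).
assert (Hg : forall y, 0 <= y <= x ->
          is_derive (fun y => f y * / sqrt (1 - y)) y (dg y)).
{ intros y Hy.
  apply (is_derive_mult f (fun y => / sqrt (1 - y))).
  - apply Hf, Hy.
  - apply is_derive_inv_sqrt_1m; lra.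
  - intros u v; apply Rmult_comm. }
destruct (MVT_gen (fun y => f y * / sqrt (1 - y)) 0 x dg) as [c [Hc Heq]].
- rewrite Rmin_left, Rmax_right by lra. intros y Hy; apply Hg; lra.
- rewrite Rmin_left, Rmax_right by lra. intros y Hy.
  apply continuity_pt_filterlim.
  apply (ex_derive_continuous (V := R_NormedModule)
           (fun y => f y * / sqrt (1 - y))).
  exists (dg y); apply Hg; lra.
- rewrite Rmin_left, Rmax_right in Hc by lra.
  assert (Hs : 0 < sqrt (1 - x)) by (apply sqrt_lt_R0; lra).
  assert (Hdg : 0 <= dg c).
  { assert (Hsc : 0 < sqrt (1 - c)) by (apply sqrt_lt_R0; lra).
    unfold dg.
    replace (df c * / sqrt (1 - c) + f c * / (2 * (1 - c) * sqrt (1 - c)))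
      with ((2 * (1 - c) * df c + f c) * / (2 * (1 - c) * sqrt (1 - c)))
      by (field; lra).
    apply Rmult_le_pos; [apply Hf; lra|].
    left; apply Rinv_0_lt_compat, Rmult_lt_0_compat; lra. }
  assert (H : f 0 <= f x * / sqrt (1 - x)).
  { rewrite Rminus_0_r, sqrt_1, Rinv_1, Rmult_1_r in Heq. nra. }
  apply Rmult_le_compat_r with (r := sqrt (1 - x)) in H; [|lra].
  rewrite Rmult_assoc, Rinv_l, Rmult_1_r in H by lra.
  exact H.
Qed.

Lemma sqrt_taylor_bounds (n : nat) (x : R) : 0 <= x <= 1 ->
  Rabs (sqrt_taylor n x - sqrt (1 - x)) <= wallis n.
Proof.
intros Hx.
pose proof (wallis_pos n) as Hw.
(* The quotient by [sqrt (1 - x)] is singular at [x = 1], but there the differential equation itself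
   reads [sqrt_taylor n 1 = wallis n]. *)
destruct (Req_dec x 1) as [-> | Hx1].
- destruct (sqrt_taylor_ode n 1) as [d [_ Hode]].
  rewrite pow1 in Hode.
  rewrite Rminus_diag, sqrt_0, Rabs_pos_eq; lra.
- assert (HD : forall y : R, is_derive (sqrt_taylor n) y (Derive (sqrt_taylor n) y)
            /\ 2 * (1 - y) * Derive (sqrt_taylor n) y + sqrt_taylor n y
               = wallis n * y ^ n).
  { intros y; destruct (sqrt_taylor_ode n y) as [d [Hd He]].
    rewrite (is_derive_unique _ _ _ Hd); split; assumption. }
  assert (Hs : 0 <= sqrt (1 - x)) by apply sqrt_pos.
  assert (Hlow : sqrt_taylor n 0 * sqrt (1 - x) <= sqrt_taylor n x).
  { apply sqrt_1m_comparison with (df := Derive (sqrt_taylor n)); [lra|].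
    intros y Hy; destruct (HD y) as [Hd He]; split; [exact Hd|].
    rewrite He; apply Rmult_le_pos; [lra | apply pow_le; lra]. }
  (* The comparison applies to [wallis n - sqrt_taylor n] as well, since its differential expression
     is [wallis n * (1 - y ^ n) >= 0]. *)
  assert (Hup : (wallis n - sqrt_taylor n 0) * sqrt (1 - x)
                <= wallis n - sqrt_taylor n x).
  { apply (sqrt_1m_comparison (fun y => wallis n - sqrt_taylor n y)
             (fun y => 0 - Derive (sqrt_taylor n) y)); [lra|].
    intros y Hy; destruct (HD y) as [Hd He]; split.
    - apply (is_derive_minus (V := R_NormedModule) (fun _ => wallis n));
        [apply (is_derive_const (V := R_NormedModule)) | exact Hd].
    - assert (Hy1 : y ^ n <= 1) by (rewrite <- (pow1 n); apply pow_incr; lra).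
      nra. }
  rewrite sqrt_taylor_at_0 in Hlow, Hup.
  rewrite Rabs_pos_eq; nra.
Qed.

(** * Integrals of powers and Taylor polynomials against [cos t ^ 2] *)

Lemma is_RInt_ext_R (f g : R -> R) (a b l : R) :
  (forall x : R, Rmin a b < x < Rmax a b -> f x = g x) ->
  is_RInt f a b l -> is_RInt g a b l.
Proof. exact (is_RInt_ext (V := R_NormedModule) f g a b l). Qed.

Lemma is_RInt_cos2_sin_pow (n : nat) :
  is_RInt (fun t => cos t ^ 2 * (sin t ^ 2) ^ n) 0 (PI / 2)
    (PI / 4 * (wallis n / (INR n + 1))).
Proof.
induction n as [|n IH].
- replace (PI / 4 * (wallis 0 / (INR 0 + 1))) with
    (((PI / 2 + sin (PI / 2) * cos (PI / 2)) / 2) - ((0 + sin 0 * cos 0) / 2))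
    by (rewrite wallis_0, cos_PI2, sin_0; simpl; field).
  apply (is_RInt_derive (fun t => (t + sin t * cos t) / 2)).
  + intros t _; auto_derive; [exact I|].
    pose proof (sin2_cos2 t) as H; unfold Rsqr in H. simpl. nra.
  + intros t _; apply (ex_derive_continuous (V := R_NormedModule)).
    auto_derive; exact I.
- pose proof (pos_INR n) as Hn.
  (* This is the derivative of [cos t ^ 3 * sin t ^ (2 n + 1)], which vanishes at both ends. Hence
     the reduction [(2 n + 1) I_n = (2 n + 4) I_(n+1)] between consecutive integrals. *)
  set (g := fun t => (2 * INR n + 1) * (cos t ^ 2 * (sin t ^ 2) ^ n) -
              (2 * INR n + 4) * (cos t ^ 2 * (sin t ^ 2) ^ S n)).
  assert (Hg : is_RInt g 0 (PI / 2) 0).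
  { replace 0 with
      (cos (PI / 2) ^ 3 * sin (PI / 2) ^ (2 * n + 1) -
       cos 0 ^ 3 * sin 0 ^ (2 * n + 1)) at 2
      by (rewrite cos_PI2, sin_0, (Nat.add_comm (2 * n)); simpl; ring).
    apply (is_RInt_derive (fun t => cos t ^ 3 * sin t ^ (2 * n + 1))).
    - intros t _; auto_derive; [exact I|].
      unfold g.
      replace (n + (n + 0) + 1)%nat with (S (2 * n)) by lia.
      change (Init.Nat.pred (S (2 * n))) with (2 * n)%nat.
      rewrite S_INR, mult_INR, <- (tech_pow_Rmult (sin t) (2 * n)),
        <- (tech_pow_Rmult (sin t ^ 2) n), <- (pow_mult _ 2 n).
      simpl (INR 2).
      pose proof (sin2_cos2 t) as H; unfold Rsqr in H.
      transitivity (cos t ^ 2 * sin t ^ (2 * n) *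
        (- 3 * sin t ^ 2 + (2 * INR n + 1) * (cos t * cos t))); [ring|].
      replace (cos t * cos t) with (1 - sin t * sin t) by lra.
      ring.
    - intros t _; apply (ex_derive_continuous (V := R_NormedModule)).
      unfold g; auto_derive; exact I. }
  replace (PI / 4 * (wallis (S n) / (INR (S n) + 1))) with
    (/ (2 * INR n + 4) *
     ((2 * INR n + 1) * (PI / 4 * (wallis n / (INR n + 1))) - 0))
    by (rewrite wallis_S, S_INR; field; lra).
  apply is_RInt_ext_R with (fun t => / (2 * INR n + 4) *
    ((2 * INR n + 1) * (cos t ^ 2 * (sin t ^ 2) ^ n) - g t)).
  + intros t _; unfold g; field; lra.
  + apply (is_RInt_scal (V := R_NormedModule)).
    apply (is_RInt_minus (V := R_NormedModule)); [|exact Hg].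
    apply (is_RInt_scal (V := R_NormedModule)), IH.
Qed.

(** The factors after [4 / PI] are, up to sign, the Taylor coefficient of [x ^ (n + 1)] and the
    integral of [cos t ^ 2 * (sin t ^ 2) ^ (n + 1)]. The recurrence turns [wallis n / (2 n + 2)]
    into [wallis (n + 1) / (2 n + 1)], which produces the square. *)
Lemma egg_coeff_S (n : nat) :
  egg_coeff (S n) =
    4 / PI * (wallis n / (2 * INR n + 2)) *
    (PI / 4 * (wallis (S n) / (INR (S n) + 1))).
Proof.
pose proof (pos_INR n) as Hn.
pose proof PI_RGT_0 as Hpi.
unfold egg_coeff. fold (wallis (S n)).
rewrite wallis_S, S_INR.
field; lra.
Qed.

Lemma is_RInt_cos2_sqrt_taylor (k : R) (n : nat) :
  is_RInt (fun t => cos t ^ 2 * sqrt_taylor (S n) (k ^ 2 * sin t ^ 2))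
    0 (PI / 2)
    (PI / 4 * (1 - sum_n (fun j => egg_coeff (S j) * k ^ (2 * S j)) n)).
Proof.
(* The value [l] stays arbitrary because [sum_n] is never empty: the base case already adds one term
   to the constant polynomial, whose integral is [PI / 4]. *)
assert (Hstep : forall m l,
  is_RInt (fun t => cos t ^ 2 * sqrt_taylor m (k ^ 2 * sin t ^ 2))
    0 (PI / 2) l ->
  is_RInt (fun t => cos t ^ 2 * sqrt_taylor (S m) (k ^ 2 * sin t ^ 2))
    0 (PI / 2) (l - PI / 4 * (egg_coeff (S m) * k ^ (2 * S m)))).
{ intros m l Hl.
  pose proof PI_RGT_0 as Hpi.
  pose proof (pos_INR m) as Hm.
  apply is_RInt_ext_R with (fun t =>
    cos t ^ 2 * sqrt_taylor m (k ^ 2 * sin t ^ 2) -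
    wallis m / (2 * INR m + 2) * k ^ (2 * S m) *
    (cos t ^ 2 * (sin t ^ 2) ^ S m)).
  - intros t _.
    change (sqrt_taylor (S m) ?x) with
      (sqrt_taylor m x - wallis m / (2 * INR m + 2) * x ^ S m).
    rewrite Rpow_mult_distr, <- (pow_mult k). ring.
  - replace (PI / 4 * (egg_coeff (S m) * k ^ (2 * S m))) with
      (wallis m / (2 * INR m + 2) * k ^ (2 * S m) *
       (PI / 4 * (wallis (S m) / (INR (S m) + 1))))
      by (rewrite egg_coeff_S, S_INR; field; lra).
    apply (is_RInt_minus (V := R_NormedModule)); [exact Hl|].
    apply (is_RInt_scal (V := R_NormedModule)), is_RInt_cos2_sin_pow. }
induction n as [|n IH].
- rewrite sum_O, Rmult_minus_distr_l.
  apply Hstep.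
  replace (PI / 4 * 1) with (PI / 4 * (wallis 0 / (INR 0 + 1)))
    by (rewrite wallis_0; simpl; field).
  apply (is_RInt_ext_R (fun t => cos t ^ 2 * (sin t ^ 2) ^ 0)).
  + intros t _; reflexivity.
  + apply is_RInt_cos2_sin_pow.
- rewrite sum_Sn.
  replace (PI / 4 * _) with
    (PI / 4 * (1 - sum_n (fun j => egg_coeff (S j) * k ^ (2 * S j)) n) -
     PI / 4 * (egg_coeff (S (S n)) * k ^ (2 * S (S n))))
    by (unfold plus; cbn -[pow egg_coeff sum_n Nat.mul]; ring).
  apply Hstep, IH.
Qed.

(** * Series expansion of the area integral on the closed interval *)

Definition egg_int (k : R) : R :=
  RInt (fun t => cos t ^ 2 * sqrt (1 - k ^ 2 * sin t ^ 2)) 0 (PI / 2).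

Lemma k2_sin2_bound (k t : R) : 0 <= k <= 1 -> 0 <= k ^ 2 * sin t ^ 2 <= 1.
Proof.
intros Hk.
pose proof (sin2_cos2 t) as H; unfold Rsqr in H.
assert (0 <= sin t ^ 2 <= 1) by (split; [apply pow2_ge_0 | nra]).
assert (0 <= k ^ 2 <= 1) by (split; [apply pow2_ge_0 | nra]).
nra.
Qed.

(** As [sqrt] is total, with value [0] on negative arguments, it is continuous on all of [R], so the
    sign of the radicand is immaterial. *)
Lemma continuous_modulus_sqrt (k t : R) :
  continuous (fun t => sqrt (1 - k ^ 2 * sin t ^ 2)) t.
Proof.
apply (continuous_comp (fun t => 1 - k ^ 2 * sin t ^ 2) sqrt).
- apply (ex_derive_continuous (V := R_NormedModule)); auto_derive; exact I.
- apply continuous_sqrt.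
Qed.

Lemma ex_RInt_egg_int (k : R) :
  ex_RInt (fun t => cos t ^ 2 * sqrt (1 - k ^ 2 * sin t ^ 2)) 0 (PI / 2).
Proof.
apply (ex_RInt_continuous (V := R_CompleteNormedModule)); intros t _.
apply (continuous_mult (K := R_AbsRing) (fun t => cos t ^ 2)).
- apply (ex_derive_continuous (V := R_NormedModule)); auto_derive; exact I.
- apply continuous_modulus_sqrt.
Qed.

(** The uniform Taylor error [wallis (S n)] is integrated over length [PI / 2] and scaled by
    [4 / PI], whence the factor [2]. *)
Lemma egg_series_partial_sum (k : R) (n : nat) : 0 <= k <= 1 ->
  Rabs (sum_n (fun j => egg_coeff (S j) * k ^ (2 * S j)) n -
        (1 - 4 / PI * egg_int k)) <= 2 * wallis (S n).
Proof.
intros Hk.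
pose proof PI_RGT_0 as Hpi.
set (s := sum_n _ n).
assert (Hdiff := is_RInt_minus (V := R_NormedModule) _ _ _ _ _ _
  (is_RInt_cos2_sqrt_taylor k n)
  (RInt_correct (V := R_CompleteNormedModule) _ _ _ (ex_RInt_egg_int k))).
fold s (egg_int k) in Hdiff.
assert (Hb : norm (minus (PI / 4 * (1 - s)) (egg_int k)) <=
             (PI / 2 - 0) * wallis (S n)).
{ apply (norm_RInt_le_const (V := R_NormedModule)) with (3 := Hdiff); [lra|].
  intros t _.
  pose proof (k2_sin2_bound k t Hk) as Hx.
  pose proof (sqrt_taylor_bounds (S n) _ Hx) as Ht.
  pose proof (sin2_cos2 t) as Hc; unfold Rsqr in Hc.
  assert (Hc1 : 0 <= cos t ^ 2 <= 1) by (split; [apply pow2_ge_0 | nra]).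
  change (Rabs (cos t ^ 2 * sqrt_taylor (S n) (k ^ 2 * sin t ^ 2) -
                cos t ^ 2 * sqrt (1 - k ^ 2 * sin t ^ 2)) <= wallis (S n)).
  rewrite <- Rmult_minus_distr_l, Rabs_mult, (Rabs_pos_eq (cos t ^ 2)) by lra.
  pose proof (Rabs_pos (sqrt_taylor (S n) (k ^ 2 * sin t ^ 2) -
                        sqrt (1 - k ^ 2 * sin t ^ 2))).
  nra. }
change (Rabs (PI / 4 * (1 - s) - egg_int k) <= (PI / 2 - 0) * wallis (S n)) in Hb.
replace (s - (1 - 4 / PI * egg_int k)) with
  (- (4 / PI * (PI / 4 * (1 - s) - egg_int k))) by (field; lra).
assert (H4 : 0 < 4 / PI) by (apply Rdiv_lt_0_compat; lra).
rewrite Rabs_Ropp, Rabs_mult, (Rabs_pos_eq (4 / PI)) by lra.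
replace (2 * wallis (S n)) with (4 / PI * ((PI / 2 - 0) * wallis (S n)))
  by (field; lra).
apply Rmult_le_compat_l; lra.
Qed.

Lemma is_series_egg (k : R) : 0 <= k <= 1 ->
  is_series (fun j => egg_coeff (S j) * k ^ (2 * S j))
    (1 - 4 / PI * egg_int k).
Proof.
intros Hk.
set (l := 1 - 4 / PI * egg_int k).
set (u := sum_n (fun j => egg_coeff (S j) * k ^ (2 * S j))).
assert (Hw : is_lim_seq (fun n => 2 * wallis (S n)) 0).
{ replace (Finite 0) with (Rbar_mult 2 0) by (simpl; f_equal; ring).
  apply is_lim_seq_scal_l, (is_lim_seq_incr_1 wallis), is_lim_seq_wallis. }
change (is_lim_seq u l).
apply is_lim_seq_le_le with
  (u := fun n => l - 2 * wallis (S n)) (w := fun n => l + 2 * wallis (S n)).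
- intros n.
  pose proof (egg_series_partial_sum k n Hk) as H.
  fold u l in H.
  apply Rabs_le_between in H; lra.
- replace (Finite l) with (Finite (l - 0)) by (f_equal; ring).
  apply is_lim_seq_minus'; [apply is_lim_seq_const | exact Hw].
- replace (Finite l) with (Finite (l + 0)) by (f_equal; ring).
  apply is_lim_seq_plus'; [apply is_lim_seq_const | exact Hw].
Qed.

(** * Identification of the integral with the area function *)

Lemma egg_int_0 : egg_int 0 = PI / 4.
Proof.
apply is_RInt_unique.
replace (PI / 4) with (PI / 4 * (wallis 0 / (INR 0 + 1)))
  by (rewrite wallis_0; simpl; field).
apply (is_RInt_ext_R (fun t => cos t ^ 2 * (sin t ^ 2) ^ 0)).
- intros t _.
  replace (1 - 0 ^ 2 * sin t ^ 2) with 1 by ring.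
  rewrite sqrt_1; reflexivity.
- apply is_RInt_cos2_sin_pow.
Qed.

Lemma egg_int_1 : egg_int 1 = 2 / 3.
Proof.
pose proof PI_RGT_0 as Hpi.
apply is_RInt_unique.
apply (is_RInt_ext_R (fun t => cos t ^ 3)).
(* On the open interval [cos t > 0], so the square root of [1 - sin t ^ 2] is [cos t] itself. *)
- rewrite Rmin_left, Rmax_right by lra. intros t Ht.
  assert (Hc : 0 < cos t) by (apply cos_gt_0; lra).
  pose proof (sin2_cos2 t) as H; unfold Rsqr in H.
  replace (1 - 1 ^ 2 * sin t ^ 2) with (cos t ^ 2) by nra.
  rewrite sqrt_pow2 by lra; ring.
- replace (2 / 3) with
    ((sin (PI / 2) - sin (PI / 2) ^ 3 / 3) - (sin 0 - sin 0 ^ 3 / 3))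
    by (rewrite sin_PI2, sin_0; field).
  apply (is_RInt_derive (fun t => sin t - sin t ^ 3 / 3)).
  + intros t _; auto_derive; [exact I|].
    pose proof (sin2_cos2 t) as H; unfold Rsqr in H.
    replace (cos t ^ 3) with (cos t * (cos t * cos t)) by ring.
    replace (cos t * cos t) with (1 - sin t * sin t) by lra.
    simpl; field.
  + intros t _; apply (ex_derive_continuous (V := R_NormedModule)).
    auto_derive; exact I.
Qed.

Lemma elliptic_eq_egg_int (k : R) : 0 < k < 1 ->
  ellK k + ellE k - ellD k = 3 * egg_int k.
Proof.
intros Hk.
set (delta := fun t => sqrt (1 - k ^ 2 * sin t ^ 2)).
assert (Hk2 : 0 < k ^ 2 < 1) by (split; nra).
assert (Hpos : forall t, 0 < 1 - k ^ 2 * sin t ^ 2).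
{ intros t.
  pose proof (sin2_cos2 t) as H; unfold Rsqr in H.
  assert (0 <= sin t ^ 2 <= 1) by (split; [apply pow2_ge_0 | nra]).
  nra. }
assert (Hd : forall t, 0 < delta t) by (intros t; apply sqrt_lt_R0, Hpos).
assert (Hd2 : forall t, delta t * delta t = 1 - k ^ 2 * sin t ^ 2).
{ intros t; apply sqrt_sqrt; left; apply Hpos. }
assert (Hcd : forall t, continuous delta t)
  by (intros t; apply continuous_modulus_sqrt).
assert (Hci : forall t, continuous (fun t => / delta t) t).
{ intros t; apply (continuous_comp delta Rinv); [apply Hcd|].
  apply continuous_Rinv; pose proof (Hd t); lra. }
assert (HK : is_RInt (fun t => / delta t) 0 (PI / 2) (ellK k)).
{ apply (RInt_correct (V := R_CompleteNormedModule)).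
  apply (ex_RInt_continuous (V := R_CompleteNormedModule)); auto. }
assert (HE : is_RInt delta 0 (PI / 2) (ellE k)).
{ apply (RInt_correct (V := R_CompleteNormedModule)).
  apply (ex_RInt_continuous (V := R_CompleteNormedModule)); auto. }
assert (HG : is_RInt (fun t => cos t ^ 2 * delta t) 0 (PI / 2) (egg_int k)).
{ apply (RInt_correct (V := R_CompleteNormedModule)), ex_RInt_egg_int. }
(* The same integrand is integrated twice: here by linearity, and in [Hzero] through its
   antiderivative [sin t * cos t * delta t]. Uniqueness of the integral then gives the identity. *)
assert (Hcomb : is_RInt (fun t => 3 * (cos t ^ 2 * delta t) -
    ((/ delta t + delta t) - / k ^ 2 * (/ delta t - delta t))) 0 (PI / 2)
    (3 * egg_int k - ((ellK k + ellE k) - / k ^ 2 * (ellK k - ellE k)))).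
{ apply (is_RInt_minus (V := R_NormedModule)).
  - apply (is_RInt_scal (V := R_NormedModule)), HG.
  - apply (is_RInt_minus (V := R_NormedModule)).
    + apply (is_RInt_plus (V := R_NormedModule)); assumption.
    + apply (is_RInt_scal (V := R_NormedModule)).
      apply (is_RInt_minus (V := R_NormedModule)); assumption. }
assert (Hzero : is_RInt (fun t => 3 * (cos t ^ 2 * delta t) -
    ((/ delta t + delta t) - / k ^ 2 * (/ delta t - delta t))) 0 (PI / 2) 0).
{ replace 0 with (sin (PI / 2) * cos (PI / 2) * delta (PI / 2) -
                  sin 0 * cos 0 * delta 0) at 2
    by (rewrite cos_PI2, sin_0; ring).
  apply (is_RInt_derive (fun t => sin t * cos t * delta t)).
  - intros t _.
    unfold delta at 1.
    auto_derive;
      replace (1 + - (k * (k * 1) * (sin t * (sin t * 1))))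
        with (1 - k ^ 2 * sin t ^ 2) by ring.
    + apply Hpos.
    + fold (delta t).
      pose proof (Hd t) as H; pose proof (Hd2 t) as H2.
      pose proof (sin2_cos2 t) as Hsc; unfold Rsqr in Hsc.
      assert (Hs : sin t * sin t = 1 - cos t * cos t) by lra.
      assert (H2' : k ^ 2 * (sin t * sin t) = 1 - delta t * delta t)
        by (rewrite H2; ring).
      (* This is the integrand of [D]. Using [k ^ 2 * sin t ^ 2 = 1 - delta t ^ 2] here and below
         eliminates [k], leaving a rational identity in [cos t] and [delta t]. *)
      replace (/ k ^ 2 * (/ delta t - delta t)) with (sin t * sin t / delta t).
      2: { replace (/ delta t - delta t) with
             ((1 - delta t * delta t) / delta t) by (field; lra).
           rewrite <- H2'; field; lra. }
      replace (sin t * cos t * _) with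
        (- (cos t ^ 2 * (k ^ 2 * (sin t * sin t)) / delta t)) by (field; lra).
      rewrite H2'.
      replace (1 * cos t * cos t + sin t * (1 * - sin t)) with
        (cos t * cos t - sin t * sin t) by ring.
      rewrite Hs; field; lra.
  - intros t _; apply (ex_derive_continuous (V := R_NormedModule)).
    unfold delta; auto_derive.
    replace (1 + - (k * (k * 1) * (sin t * (sin t * 1))))
      with (1 - k ^ 2 * sin t ^ 2) by ring.
    pose proof (Hpos t) as Hp; pose proof (Hd t) as H; unfold delta in H.
    repeat split; lra. }
apply (is_RInt_unique (V := R_CompleteNormedModule)) in Hcomb.
apply (is_RInt_unique (V := R_CompleteNormedModule)) in Hzero.
rewrite Hzero in Hcomb.
unfold ellD, Rdiv. lra.
Qed.

Lemma egg_area_eq_egg_int (a b q k : R) : 0 <= k <= 1 ->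
  egg_area a b q k = 4 * a * b * q * egg_int k.
Proof.
intros Hk. unfold egg_area.
destruct (Req_EM_T k 0) as [-> | H0]; [rewrite egg_int_0; field|].
destruct (Req_EM_T k 1) as [-> | H1]; [rewrite egg_int_1; field|].
rewrite elliptic_eq_egg_int by lra; field.
Qed.

(** * Radius of convergence *)

Lemma egg_pcoeff_even (i : nat) : egg_pcoeff (2 * S i) = egg_coeff (S i).
Proof.
unfold egg_pcoeff.
rewrite Nat.div2_double, Nat.even_mul; reflexivity.
Qed.

Lemma egg_coeff_eq (i : nat) :
  egg_coeff i = wallis i ^ 2 / ((2 * INR i - 1) * (INR i + 1)).
Proof. unfold egg_coeff; fold (wallis i); unfold Rdiv; ring. Qed.

Lemma INR_ge_1 (i : nat) : (1 <= i)%nat -> 1 <= INR i.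
Proof. exact (le_INR 1 i). Qed.

(** The lower bound multiplies [wallis i ^ 2 >= 1 / (4 i ^ 2)] by
    [1 / ((2 i - 1) (i + 1)) >= 1 / (4 i ^ 2)]. Such polynomial decay cannot offset the growth of
    [r ^ (2 i)] for [r > 1]. *)
Lemma egg_coeff_bounds (i : nat) : (1 <= i)%nat ->
  / (16 * INR i ^ 4) <= egg_coeff i <= 1.
Proof.
intros Hi.
pose proof (INR_ge_1 i Hi) as H1.
pose proof (wallis_ge i Hi) as Hlow.
pose proof (wallis_sqr_le i) as Hup.
pose proof (wallis_pos i) as Hw.
set (x := INR i) in *.
assert (Hden : 1 <= (2 * x - 1) * (x + 1)) by nra.
rewrite egg_coeff_eq; fold x; split.
- apply Rle_div_r; [lra|].
  apply Rle_trans with (/ (4 * x ^ 2)).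
  + replace (/ (16 * x ^ 4)) with (/ (4 * x ^ 2) * / (4 * x ^ 2))
      by (field; lra).
    rewrite Rmult_assoc.
    apply Rle_trans with (/ (4 * x ^ 2) * 1); [|lra].
    apply Rmult_le_compat_l; [left; apply Rinv_0_lt_compat; nra|].
    rewrite Rmult_comm; apply Rle_div_l; nra.
  + replace (wallis i ^ 2) with ((2 * x * wallis i) ^ 2 * / (4 * x ^ 2))
      by (field; lra).
    apply Rle_trans with (1 * / (4 * x ^ 2)); [lra|].
    apply Rmult_le_compat_r; [left; apply Rinv_0_lt_compat; nra|].
    rewrite <- (pow1 2); apply pow_incr; lra.
- apply Rle_div_l; nra.
Qed.

(** The radius is the least upper bound of the [r] for which the terms stay bounded: they are
    unbounded for every [r > 1] and bounded by [1] at [r = 1]. *)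
Lemma CV_radius_egg_pcoeff : CV_radius egg_pcoeff = Finite 1.
Proof.
destruct (CV_radius_bounded egg_pcoeff) as [Hub Hlub].
apply Rbar_le_antisym.
- apply Hlub; intros r [M HM]; simpl.
  apply Rnot_lt_le; intros Hr.
  (* Along [i = 5 m], Bernoulli's inequality gives [r ^ (2 i) >= (2 m h) ^ 5],
     one power of [m] more than the coefficient can absorb. *)
  set (h := r - 1).
  assert (Hh : 0 < h) by (unfold h; lra).
  (* With [m = N + 1], the term at [i = 5 m] is at least [(2 m h) ^ 5 / (16 (5 m) ^ 4) = 32 h ^ 5 m
     / 10000], and [N] makes this exceed [M]. The maximum with [0] supplies the nonnegativity that
     [nfloor_ex] asks for. *)
  destruct (nfloor_ex (Rmax 0 (M * 10000 / (32 * h ^ 5)))) as [N [_ HN]];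
    [apply Rmax_l|].
  pose proof (Rmax_r 0 (M * 10000 / (32 * h ^ 5))) as HN'.
  set (x := INR (S N)).
  assert (Hx : 1 <= x) by (apply INR_ge_1; lia).
  assert (Hxi : INR (5 * S N) = 5 * x)
    by (rewrite mult_INR; fold x; simpl (INR 5); lra).
  assert (HMx : M < 32 * h ^ 5 * x / 10000).
  { assert (Hh5 : 0 < 32 * h ^ 5)
      by (apply Rmult_lt_0_compat; [lra | apply pow_lt, Hh]).
    apply Rlt_div_r; [lra|].
    rewrite (Rmult_comm (32 * h ^ 5)).
    apply Rlt_div_l; [exact Hh5|].
    unfold x; rewrite S_INR; lra. }
  (* The index is [2 * (5 * S N)], written as the double of a successor to match
     [egg_pcoeff_even]. *)
  specialize (HM (2 * S (4 + 5 * N))%nat).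
  rewrite egg_pcoeff_even in HM.
  replace (S (4 + 5 * N)) with (5 * S N)%nat in HM by lia.
  destruct (egg_coeff_bounds (5 * S N)) as [Hc _]; [lia|].
  rewrite Hxi in Hc.
  assert (Hpow : (2 * x * h) ^ 5 <= r ^ (2 * (5 * S N))).
  { replace (2 * (5 * S N))%nat with (2 * S N * 5)%nat by lia.
    rewrite pow_mult; apply pow_incr; split; [nra|].
    pose proof (poly (2 * S N) h Hh) as Hb.
    replace (1 + h) with r in Hb by (unfold h; ring).
    rewrite mult_INR in Hb; fold x in Hb; simpl (INR 2) in Hb; lra. }
  assert (Hprod : / (16 * (5 * x) ^ 4) * (2 * x * h) ^ 5 <=
                  egg_coeff (5 * S N) * r ^ (2 * (5 * S N))).
  { apply Rmult_le_compat; [| |exact Hc|exact Hpow].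
    - left; apply Rinv_0_lt_compat, Rmult_lt_0_compat; [|apply pow_lt]; lra.
    - apply pow_le; nra. }
  replace (/ (16 * (5 * x) ^ 4) * (2 * x * h) ^ 5) with
    (32 * h ^ 5 * x / 10000) in Hprod by (field; lra).
  pose proof (Rle_abs (egg_coeff (5 * S N) * r ^ (2 * (5 * S N)))).
  lra.
- apply Hub; exists 1; intros n.
  rewrite pow1, Rmult_1_r.
  unfold egg_pcoeff.
  destruct (Nat.even n && (0 <? n)%nat)%bool eqn:Hn;
    [|rewrite Rabs_R0; lra].
  apply andb_prop in Hn; destruct Hn as [He Hn].
  apply Nat.ltb_lt in Hn; apply Nat.even_spec in He; destruct He as [i ->].
  rewrite Nat.div2_double.
  destruct (egg_coeff_bounds i) as [Hl Hu]; [lia|].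
  rewrite Rabs_pos_eq; [exact Hu|].
  apply Rle_trans with (2 := Hl); left.
  apply Rinv_0_lt_compat, Rmult_lt_0_compat; [lra|].
  apply pow_lt, lt_0_INR; lia.
Qed.

Theorem mainTheorem2 (a b q : R) (ha : 0 < a) (hb : 0 < b) (hq : 0 < q <= 1) :
  (forall k : R, 0 < k < 1 ->
     ex_series (fun j : nat => egg_coeff (S j) * k ^ (2 * S j)) /\
     egg_area a b q k =
       a * b * q * PI -
       a * b * q * PI * Series (fun j : nat => egg_coeff (S j) * k ^ (2 * S j))) /\
  CV_radius egg_pcoeff = Finite 1 /\
  ex_series (fun j : nat => egg_coeff (S j) * 1 ^ (2 * S j)) /\
  egg_area a b q 0 =
    a * b * q * PI -
    a * b * q * PI * Series (fun j : nat => egg_coeff (S j) * 0 ^ (2 * S j)) /\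
  egg_area a b q 1 =
    a * b * q * PI -
    a * b * q * PI * Series (fun j : nat => egg_coeff (S j) * 1 ^ (2 * S j)).
Proof.
pose proof PI_RGT_0 as Hpi.
(* The partial sum bound is uniform on the closed interval, so both endpoints are covered without an
   Abel-type limit. *)
assert (Hmain : forall k, 0 <= k <= 1 ->
  ex_series (fun j : nat => egg_coeff (S j) * k ^ (2 * S j)) /\
  egg_area a b q k =
    a * b * q * PI -
    a * b * q * PI * Series (fun j : nat => egg_coeff (S j) * k ^ (2 * S j))).
{ intros k Hk.
  pose proof (is_series_egg k Hk) as Hs.
  split; [eexists; exact Hs|].
  rewrite (is_series_unique _ _ Hs), egg_area_eq_egg_int by exact Hk.
  field; lra. }
repeat split.
- apply Hmain; lra.
- apply Hmain; lra.
- exact CV_radius_egg_pcoeff.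
- apply Hmain; lra.
- apply Hmain; lra.
- apply Hmain; lra.
Qed.
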